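(* Let $\Delta t>0$ and let $(U^n)_{n\ge0}$ be a bounded sequence in $\mathbb{R}^M$ which complies with the BDF3 scheme $$\frac{11}{6}U^{n+3}-3U^{n+2}+\frac32U^{n+1}-\frac13U^n\in-\Delta t\,\partial F(U^{n+3}),\quad n\ge0.$$ If $c_F\Delta t<2\beta_3$, then $\partial U^n\to0$ as $n\to+\infty$, and $\omega((U^n)_n)$ is a compact and connected subset of $\mathbb{R}^M$ included in $\mathcal{S}$.
   Context: Assumptions on $F$. $\mathbb{R}^M$ carries the Euclidean norm $\|\cdot\|$ and scalar product $\langle\cdot,\cdot\rangle$. $F:\mathbb{R}^M\to\mathbb{R}\cup\{+\infty\}$ is proper and lower semicontinuous, and semiconvex: there is a constant $c\ge0$ such that $V\mapsto F(V)+\frac{c}{2}\|V\|^2$ is convex; $c_F\ge0$ denotes the smallest such constant. Moreover $F$ is continuous on its domain $\mathrm{dom}(F)=\{V: F(V)<+\infty\}$, and $\inf_{\mathbb{R}^M}F>-\infty$. The subdifferential $\partial F$ is the set-valued map on $\mathbb{R}^M$ defined by $$W\in\partial F(V)\iff\forall V'\in\mathbb{R}^M,\ F(V')\ge F(V)+\langle W,V'-V\rangle-\frac{c_F}{2}\|V'-V\|^2,$$ with $\partial F(V)=\emptyset$ if $V\notin\mathrm{dom}(F)$. Notation. $\partial U^n=U^n-U^{n-1}$ ($n\ge1$). The $\omega$-limit set is $\omega((U^n)_n)=\{U^\star\in\mathbb{R}^M : \exists\, n_p\to+\infty\text{ such that }U^{n_p}\to U^\star\}$. The set of critical points of $F$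 is $\mathcal{S}=\{V\in\mathbb{R}^M : 0\in\partial F(V)\}$. The constant $\beta_3$. Let $\gamma_3(x_1,x_2,x_3)=\frac{11}{6}x_1^2-\frac76x_1x_2+\frac13x_1x_3$ on $\mathbb{R}^3$. $\beta_3$ is the supremum of the real numbers $\beta>0$ for which there exist a positive definite quadratic form $q_3$ on $\mathbb{R}^2$ and a positive definite quadratic form $\tilde r_3$ on $\mathbb{R}^3$ with $$\gamma_3(x_1,x_2,x_3)=q_3(x_1,x_2)-q_3(x_2,x_3)+\tilde r_3(x_1,x_2,x_3)+\beta x_1^2\quad\text{for all }(x_1,x_2,x_3)\in\mathbb{R}^3;$$ its value is $\beta_3=95/96$. *)

(* Defs.v *)
From HB Require Import structures.
From mathcomp Require Import all_boot all_order all_algebra.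
From mathcomp Require Import all_classical all_reals all_analysis.

Set Implicit Arguments.
Unset Strict Implicit.
Unset Printing Implicit Defensive.

Import Order.TTheory GRing.Theory Num.Theory.
Import numFieldNormedType.Exports.

Local Open Scope classical_set_scope.
Local Open Scope ring_scope.

(* The norm that the library attaches to 'rV[R]_M is the max norm.  It induces
   the same topology as [enorm], so limits, compactness and connectedness are
   the library's, but every metric inequality is stated with [enorm]. *)

Definition scalprod (R : realType) (M : nat) (V W : 'rV[R]_M) : R :=
  \sum_(i < M) V 0 i * W 0 i.

Definition enorm (R : realType) (M : nat) (V : 'rV[R]_M) : R :=
  Num.sqrt (scalprod V V).

(* Functions R^M -> R U {+oo} have codomain \bar R; the value -oo is excluded
   by [eproper]. *)

Definition edom (R : realType) (M : nat) (F : 'rV[R]_M -> \bar R) :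
    set 'rV[R]_M :=
  [set V | (F V < +oo)%E].

Definition eproper (R : realType) (M : nat) (F : 'rV[R]_M -> \bar R) : Prop :=
  (forall V, F V != -oo%E) /\ edom F !=set0.

(* With 0 * +oo = 0, the inequality is trivially true at t = 0 and t = 1. *)
Definition econvex (R : realType) (M : nat) (G : 'rV[R]_M -> \bar R) : Prop :=
  forall (V W : 'rV[R]_M) (t : R), 0 <= t <= 1 ->
    (G (t *: V + (1 - t) *: W)%R <= t%:E * G V + (1 - t)%:E * G W)%E.

Definition semiconvex_with (R : realType) (M : nat) (F : 'rV[R]_M -> \bar R)
    (c : R) : Prop :=
  0 <= c /\ econvex (fun V => (F V + (c / 2 * enorm V ^+ 2)%:E)%E).

(* The smallest admissible c: when the set is nonempty this infimum is
   attained, since the inequalities defining it are closed conditions on c. *)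
Definition semiconvexity_const (R : realType) (M : nat)
    (F : 'rV[R]_M -> \bar R) : R :=
  inf [set c | semiconvex_with F c].

Definition subdiff (R : realType) (M : nat) (F : 'rV[R]_M -> \bar R)
    (V : 'rV[R]_M) : set 'rV[R]_M :=
  [set W | edom F V /\
    forall V' : 'rV[R]_M,
      (F V + (scalprod W (V' - V)
              - semiconvexity_const F / 2 * enorm (V' - V) ^+ 2)%:E
       <= F V')%E].

Definition critical_points (R : realType) (M : nat)
    (F : 'rV[R]_M -> \bar R) : set 'rV[R]_M :=
  [set V | subdiff F V 0].

Definition omega_limit (R : realType) (M : nat) (U : nat -> 'rV[R]_M) :
    set 'rV[R]_M :=
  [set Ustar | exists np : nat -> nat,
    np p @[p --> \oo] --> \oo /\ U (np p) @[p --> \oo] --> Ustar].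

(* Only used for n >= 1; the value at n = 0 is 0. *)
Definition bdiff (R : realType) (M : nat) (U : nat -> 'rV[R]_M) (n : nat) :
    'rV[R]_M :=
  U n - U n.-1.

Definition posdef_quadratic_form (R : realType) (n : nat)
    (q : 'rV[R]_n -> R) : Prop :=
  (exists2 A : 'M[R]_n, A^T = A & forall x, q x = (x *m A *m x^T) 0 0) /\
  (forall x, x != 0 -> 0 < q x).

Definition vec2 (R : realType) (x1 x2 : R) : 'rV[R]_2 :=
  \row_(i < 2) [:: x1; x2]`_i.

Definition vec3 (R : realType) (x1 x2 x3 : R) : 'rV[R]_3 :=
  \row_(i < 3) [:: x1; x2; x3]`_i.

Definition gamma3 (R : realType) (x1 x2 x3 : R) : R :=
  11 / 6 * x1 ^+ 2 - 7 / 6 * x1 * x2 + 1 / 3 * x1 * x3.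

Definition beta3_admissible (R : realType) (beta : R) : Prop :=
  0 < beta /\
  exists (q3 : 'rV[R]_2 -> R) (r3 : 'rV[R]_3 -> R),
    [/\ posdef_quadratic_form q3, posdef_quadratic_form r3 &
        forall x1 x2 x3 : R,
          gamma3 x1 x2 x3 =
            q3 (vec2 x1 x2) - q3 (vec2 x2 x3) + r3 (vec3 x1 x2 x3)
            + beta * x1 ^+ 2].

Definition beta3 (R : realType) : R := sup [set beta : R | beta3_admissible beta].

(* Main.v *)
(** The scheme reads [- dt W = 11/6 d_n - 7/6 d_(n-1) + 1/3 d_(n-2)] with
    [d_n] the increments and [W] a subgradient at the newest point.  Testing it
    against [d_n] gives [gamma3] applied coordinatewise, and the subgradient
    inequality bounds the same quantity by [dt] times the decrease of [F], up to
    [c_F dt / 2 |d_n|^2].  Hence [dt F(U^n) + q3(d_n, d_(n-1))] is a Lyapunov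
    function dissipating a positive multiple of [|d_n|^2], so [d_n] tends to 0.
    Then [W] tends to 0 as well, and lower semicontinuity passes the subgradient
    inequality to the limit along subsequences.  Compactness and connectedness
    hold for the cluster set of any sequence in a compact set whose increments
    tend to 0. *)
Require Import Defs.
From HB Require Import structures.
From mathcomp Require Import all_boot all_order all_algebra.
From mathcomp Require Import all_classical all_reals all_analysis.
From mathcomp Require Import ring lra zify.

Set Implicit Arguments.
Unset Strict Implicit.
Unset Printing Implicit Defensive.

Import Order.TTheory GRing.Theory Num.Theory.
Import numFieldNormedType.Exports.

Local Open Scope classical_set_scope.
Local Open Scope ring_scope.

(** * Cluster points of sequences with vanishing increments *)

Definition frequently (P : nat -> Prop) := forall N, exists2 n, (N <= n)%N & P n.

(** From an index in [P], go to a later one in [Q], hence outside [P]; walking back from there, the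
    first index found in [P] is an exit. *)
Lemma frequently_crossing (P Q : set nat) :
  frequently P -> frequently Q -> P `&` Q = set0 ->
  frequently (fun n => P n /\ ~ P n.+1).
Proof.
move=> fP fQ PQ N; have [m Nm Pm] := fP N; have [q mq Qq] := fQ m.
have nPq : ~ P q by move=> Pq; have : set0 q by rewrite -PQ.
move: nPq; rewrite -(subnKC mq); elim: (q - m)%N => [|k IHk] => nP.
  by move: nP; rewrite addn0.
have [Pk|nPk] := pselect (P (m + k)%N); last exact: IHk.
by exists (m + k)%N; [lia|split=> //; rewrite -addnS].
Qed.

(** Frequency of [P] makes the filter of tails restricted to [P] proper, so compactness yields a
    cluster point along the indices in [P] alone. *)
Lemma compact_frequently (T : topologicalType) (K : set T) (u : nat -> T)
    (P : nat -> Prop) :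
  compact K -> (forall n, K (u n)) -> frequently P ->
  exists x : T, forall A, nbhs x A -> frequently (fun n => P n /\ A (u n)).
Proof.
move=> cK Ku fP.
pose G := u @ within P \oo.
have GP : ProperFilter G.
  apply: fmap_proper_filter; apply: Build_ProperFilter_ex => B.
  case=> N _ NB; have [n Nn Pn] := fP N; exists n; exact: NB.
have GK : G K by exists 0%N => // n _ _; exact: Ku.
have [x [_ xG]] := cK G GP GK.
exists x => A xA N.
have GN : G (u @` [set n | P n /\ (N <= n)%N]).
  by exists N => // n /= Nn Pn; exists n.
by have [_ [[n [Pn Nn] <-] Aun]] := xG _ _ GN xA; exists n.
Qed.

Lemma clusternP (T : topologicalType) (u : nat -> T) (x : T) :
  cluster (u @ \oo) x <-> forall A, nbhs x A -> frequently (fun n => A (u n)).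
Proof.
split=> [xu A xA N|xu B A [N _ NB] xA].
  have uN : (u @ \oo) (u @` [set n | (N <= n)%N]).
    by exists N => // n /= Nn; exists n.
  by have [_ [[n Nn <-] Aun]] := xu _ _ uN xA; exists n.
by have [n Nn An] := xu A xA N; exists (u n); split => //; exact: NB.
Qed.

(* Disjoint open neighbourhoods separate two putative pieces of the cluster
   set; the sequence leaves the first one infinitely often, and the steps at
   which it does so accumulate in neither piece. *)
Lemma connected_cluster_slow (R : realType) (V : normedModType R) (K : set V)
    (u : nat -> V) :
  compact K -> (forall n, K (u n)) ->
  u n.+1 - u n @[n --> \oo] --> (0 : V) ->
  connected (cluster (u @ \oo)).
Proof.
move=> cK Ku du; apply: contrapT => /connectedPn[E [E0 uE [sE1 sE2]]].
have cl_u : closed (cluster (u @ \oo)).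
  by rewrite clusterE; apply: closed_bigI => A _; exact: closed_closure.
(* A limit of points of one piece lies in the closed cluster set, and separation keeps it out of the
   other piece. *)
have cl_E b : closed (E b).
  have : closure (E b) `<=` E b; last by [].
  move=> x Ex.
  have : cluster (u @ \oo) x.
    apply: cl_u; apply: closureS Ex; rewrite uE; case: b => y Ey; by [left|right].
  rewrite uE => -[] Ebx; case: b Ex Ebx => // Ex Ebx; exfalso.
    by have : set0 x by rewrite -sE2.
  by have : set0 x by rewrite -sE1.
have dE : E false `&` E true = set0.
  by rewrite -[RHS]sE1 -((closure_id _).1 (cl_E false)).
have [A [B [oA oB EA EB AB]]] :=
  (@normal_openP R V).1 pseudometric_normal _ _ (cl_E false) (cl_E true) dE.
have inf_E b O : E b `<=` O -> open O -> frequently (fun n => O (u n)).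
  move=> EO oO; have [x Ex] := E0 b.
  have /clusternP : cluster (u @ \oo) x by rewrite uE; case: b Ex {EO}; [right|left].
  by apply; apply: open_nbhs_nbhs; split => //; exact: EO.
have fAB : frequently (fun n => A (u n) /\ ~ A (u n.+1)).
  apply: (@frequently_crossing [set n | A (u n)] [set n | B (u n)]).
  - exact: (inf_E false).
  - exact: (inf_E true).
  - apply/seteqP; split => n //= [An Bn].
    by have : set0 (u n) by rewrite -AB.
have [x xf] := compact_frequently cK Ku fAB.
have : cluster (u @ \oo) x.
  apply/clusternP => C xC N; have [n Nn [_ Cn]] := xf C xC N; by exists n.
(* If [x] is in [B], exit terms, which lie in [A], enter [B]: impossible. If [x] is in [A], a term
   within [e / 2] of [x] followed by a step shorter than [e / 2] stays in [A]. *)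
rewrite uE => -[/EA Ax|/EB Bx]; last first.
  have xB : nbhs x B by exact: open_nbhs_nbhs.
  have [n _ [[An _] Bn]] := xf B xB 0%N.
  by have : set0 (u n) by rewrite -AB.
have /nbhs_ballP[e /= e0 xeA] : nbhs x A by exact: open_nbhs_nbhs.
have e20 : 0 < e / 2 by rewrite divr_gt0.
have [N _ dN] := (cvgr0Pnorm_lt _).1 du _ e20.
have [n Nn [[_ nA] xn]] := xf _ (nbhsx_ballx x _ e20) N.
apply: nA; apply: xeA; rewrite (splitr e).
apply: ball_triangle xn _.
by rewrite -ball_normE /= distrC; exact: dN.
Qed.

(** * Euclidean norm and omega-limit set *)

Section euclidean.
Variables (R : realType) (M : nat).
Implicit Types V W : 'rV[R]_M.

Lemma scalprod_ge0 V : 0 <= scalprod V V.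
Proof. by apply: sumr_ge0 => i _; rewrite -expr2 sqr_ge0. Qed.

Lemma enorm_sqr V : enorm V ^+ 2 = scalprod V V.
Proof. by rewrite sqr_sqrtr ?scalprod_ge0. Qed.

Lemma normr_le_enorm V : `|V| <= enorm V.
Proof.
rewrite [`|V|]mx_normrE; apply: bigmax_le; first exact: sqrtr_ge0.
move=> [i j] _ /=; rewrite (ord1 i) -sqrtr_sqr ler_sqrt ?scalprod_ge0//.
rewrite /scalprod (bigD1 j)//= expr2 lerDl.
by apply: sumr_ge0 => k _; rewrite -expr2 sqr_ge0.
Qed.

Lemma cvg_scalprod (T : Type) (G : set_system T) (FG : Filter G)
    (u v : T -> 'rV[R]_M) V W :
  u @ G --> V -> v @ G --> W ->
  scalprod (u x) (v x) @[x --> G] --> scalprod V W.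
Proof.
move=> uV vW.
apply: (@cvg_big _ _ _ _ _ _ _ G _ (fun i x => u x 0 i * v x 0 i)).
  exact: add_continuous.
move=> i _; apply: cvgM.
  exact: (continuous_cvg _ (@coord_continuous _ _ _ 0 i V) uV).
exact: (continuous_cvg _ (@coord_continuous _ _ _ 0 i W) vW).
Qed.

Lemma cvg_scalprod_self0 (u : nat -> 'rV[R]_M) :
  scalprod (u n) (u n) @[n --> \oo] --> (0 : R) ->
  u @ \oo --> (0 : 'rV[R]_M).
Proof.
move=> u0; apply: norm_cvg0.
apply: (@squeeze_cvgr _ _ _ _ (cst 0) (fun n => enorm (u n))).
- by near=> n; rewrite normr_ge0 normr_le_enorm.
- exact: cvg_cst.
- rewrite -[X in _ --> X]sqrtr0.
  exact: (continuous_cvg _ (@sqrt_continuous R 0) u0).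
Unshelve. all: by end_near. Qed.

(** For a cluster point, balls of radius [1 / (p + 1)] select indices [np p >= p], which therefore
    tend to infinity. *)
Lemma omega_limitE (U : nat -> 'rV[R]_M) :
  omega_limit U = cluster (U @ \oo).
Proof.
apply/seteqP; split=> x.
  move=> [np [npoo Ux]]; apply/clusternP => A xA N.
  have npN : \forall p \near \oo, (N <= np p)%N by exact: (cvgnyPge np).1 npoo N.
  have UA : \forall p \near \oo, A (U (np p)) by exact: Ux.
  by have [p [Np Ap]] := filter_ex (filterI npN UA); exists (np p).
move=> /clusternP Ux.
have /choice[np npP] p : exists n, (p <= n)%N /\ ball x p.+1%:R^-1 (U n).
  have p0 : 0 < p.+1%:R^-1 :> R by rewrite invr_gt0.
  by have [n pn xn] := Ux _ (nbhsx_ballx x _ p0) p; exists n.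
exists np; split.
  apply/cvgnyPge => N; near=> p.
  apply: leq_trans (npP p).1; near: p; exact: nbhs_infty_ge.
apply/cvgrPdist_lt => e e0; near=> p.
have := (npP p).2; rewrite -ball_normE /= => /lt_trans; apply.
near: p; exact: (near_infty_natSinv_lt (PosNum e0)).
Unshelve. all: by end_near. Qed.

End euclidean.

(** * Dissipation and the constants [c_F] and [beta3] *)

(** [E] decreases and is bounded below, so it converges; its successive drops, which dominate
    [k * a n], tend to 0. *)
Lemma cvg0_dissipation (R : realType) (E a : nat -> R) (k m : R) :
  0 < k -> (forall n, 0 <= a n) -> (forall n, m <= E n) ->
  (forall n, E n.+1 + k * a n <= E n) -> a @ \oo --> (0 : R).
Proof.
move=> k0 a0 mE dE.
have dec : {homo E : p q / (p <= q)%N >-> q <= p}.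
  apply/nonincreasing_seqP => n; apply: le_trans (dE n).
  by rewrite lerDl mulr_ge0 // ltW.
have Ecvg := nonincreasing_cvgn dec (ex_intro _ m _).
have {}Ecvg : E @ \oo --> inf (range E) by apply: Ecvg => _ [n _ <-].
apply: (@squeeze_cvgr _ _ _ _ (cst 0) (fun n => k^-1 * (E n - E n.+1))).
- near=> n; rewrite a0 /= mulrC ler_pdivlMr // mulrC lerBrDl; exact: dE.
- exact: cvg_cst.
- rewrite -[X in _ --> X](mulr0 k^-1) -[X in _ * X](subrr (inf (range E))).
  by apply: cvgMr; apply: cvgB => //; rewrite cvg_shiftS.
Unshelve. all: by end_near. Qed.

Lemma semiconvexity_const_ge0 (R : realType) (M : nat) (F : 'rV[R]_M -> \bar R) :
  0 <= semiconvexity_const F.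
Proof.
rewrite /semiconvexity_const.
have [[c Fc]|/set0P/negP/negPn/eqP ->] :=
  pselect ([set c | semiconvex_with F c] !=set0); last by rewrite inf0.
by apply: lb_le_inf; [exists c | move=> y []].
Qed.

(** Only an admissible [beta] comes with quadratic forms, so the supremum is traded for one. The
    bound [0 <= x] excludes an empty set, whose [sup] is 0 by convention. *)
Lemma lt_beta3_admissible (R : realType) (x : R) :
  0 <= x -> x < 2 * beta3 R -> exists2 beta, beta3_admissible beta & x < 2 * beta.
Proof.
move=> x0; rewrite /beta3 => xb.
have [S0|/set0P/negP/negPn/eqP S0] :=
  pselect ([set beta : R | beta3_admissible beta] !=set0).
  have /(sup_gt S0)[b adm_b xlt] : x / 2 < sup [set beta : R | beta3_admissible beta].
    lra.
  by exists b => //; lra.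
by move: xb; rewrite S0 sup0; lra.
Qed.

(** Dropping the nonnegative [r3] turns the identity for [gamma3] into an inequality. *)
Lemma beta3_admissible_dissipation (R : realType) (beta : R) :
  beta3_admissible beta ->
  exists2 q : R -> R -> R, (forall x1 x2, 0 <= q x1 x2) &
    forall x1 x2 x3, q x1 x2 + beta * x1 ^+ 2 <= q x2 x3 + gamma3 x1 x2 x3.
Proof.
have posdef_ge0 n (q : 'rV[R]_n -> R) x : posdef_quadratic_form q -> 0 <= q x.
  move=> [[A _ qE] q0]; have [->|/q0/ltW//] := eqVneq x 0.
  by rewrite qE !mul0mx mxE.
move=> [_ [q3 [r3 [q3pos r3pos gammaE]]]].
exists (fun x1 x2 => q3 (vec2 x1 x2)) => [x1 x2|x1 x2 x3]; first exact: posdef_ge0.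
rewrite gammaE; have := posdef_ge0 _ _ (vec3 x1 x2 x3) r3pos; lra.
Qed.

(** * Critical limit points and decay of the increments for BDF3 *)

Section BDF3.
Variables (R : realType) (M : nat) (F : 'rV[R]_M -> \bar R).
Hypothesis F_proper : eproper F.

Lemma edom_fineK V : edom F V -> (fine (F V))%:E = F V.
Proof. by move=> dV; rewrite fineK // fin_numE F_proper.1 lt_eqF. Qed.

Lemma subdiff_fine (V W V' : 'rV[R]_M) :
  subdiff F V W -> edom F V' ->
  fine (F V) + (scalprod W (V' - V)
                - semiconvexity_const F / 2 * enorm (V' - V) ^+ 2)
    <= fine (F V').
Proof.
by move=> [dV /(_ V') + dV']; rewrite -(edom_fineK dV) -(edom_fineK dV') -EFinD lee_fin.
Qed.

Lemma omega_limit_subset_critical (U W : nat -> 'rV[R]_M) :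
  (forall n, subdiff F (U n.+3) (W n)) ->
  lower_semicontinuous F -> W @ \oo --> (0 : 'rV[R]_M) ->
  omega_limit U `<=` critical_points F.
Proof.
move=> W_subdiff F_lsc W0 x [np [npoo Ux]].
set c := semiconvexity_const F.
(* [W n] belongs to [U n.+3], so [U (np p)] is paired with [W (np p - 3)]; the subtraction is
   truncated, hence [np3]. *)
have sub3oo : (np p - 3)%N @[p --> \oo] --> \oo.
  exact: (cvg_comp np (subn^~ 3%N) npoo (@cvg_subnr 3)).
have Wx : W (np p - 3)%N @[p --> \oo] --> (0 : 'rV[R]_M).
  exact: (cvg_comp _ W sub3oo W0).
have np3 : \forall p \near \oo, (3 <= np p)%N.
  exact: (cvgnyPge _).1 npoo 3%N.
have key V' : edom F V' -> (F x <= (fine (F V') + c / 2 * enorm (V' - x) ^+ 2)%:E)%E.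
  move=> dV'.
  (* For [np p >= 3], the subgradient inequality bounds [F (U (np p))] by [g p]. *)
  pose g p := fine (F V') - (scalprod (W (np p - 3)%N) (V' - U (np p))
    - c / 2 * scalprod (V' - U (np p)) (V' - U (np p))).
  have gcvg : g @ \oo --> fine (F V') + c / 2 * enorm (V' - x) ^+ 2.
    rewrite enorm_sqr -[X in _ --> _ + X]opprK.
    have -> : - (c / 2 * scalprod (V' - x) (V' - x))
        = scalprod 0 (V' - x) - c / 2 * scalprod (V' - x) (V' - x).
      by rewrite [scalprod 0 _]big1 ?sub0r// => i _; rewrite mxE mul0r.
    have VU : V' - U (np p) @[p --> \oo] --> V' - x.
      by apply: cvgB => //; exact: cvg_cst.
    apply: cvgB; first exact: cvg_cst.
    by apply: cvgB; [|apply: cvgMr]; apply: cvg_scalprod.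
  (* Otherwise a real [a] fits strictly between, even if [F x] is infinite: near [x], [F] exceeds
     [a] by semicontinuity, while [g p < a] eventually. *)
  rewrite leNgt; apply/negP => lt_x.
  have [a a1 a2] : exists2 a : R,
      fine (F V') + c / 2 * enorm (V' - x) ^+ 2 < a & (a%:E < F x)%E.
    move: lt_x; set b := fine (F V') + _; case: (F x) => [r| |] //=.
      by rewrite lte_fin => br; exists ((b + r) / 2); rewrite ?lte_fin; lra.
    by move=> _; exists (b + 1); rewrite ?ltry // ltrDl.
  have [N xN aF] := F_lsc x a a2.
  have UN : \forall p \near \oo, N (U (np p)) by exact: Ux.
  have ga : \forall p \near \oo, g p < a by exact: (cvgr_lt _ gcvg).
  have [p [p3 [Np gp]]] := filter_ex (filterI np3 (filterI UN ga)).
  have := W_subdiff (np p - 3)%N; rewrite (_ : (np p - 3).+3 = np p); last by lia.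
  move=> Wp; have := subdiff_fine Wp dV'; have := aF _ Np.
  rewrite -(edom_fineK Wp.1).
  rewrite lte_fin enorm_sqr; move: gp; rewrite /g -/c; lra.
(* Finiteness of [F x] comes from [key] at any point of the domain. *)
have dx : edom F x.
  have [V0 dV0] := F_proper.2.
  by apply: le_lt_trans (key V0 dV0) _; rewrite ltry.
split=> // V'.
have [dV'|] := pselect (edom F V'); last first.
  by move/negP; rewrite -leNgt leye_eq => /eqP ->; rewrite leey.
have := key V' dV'.
rewrite -(edom_fineK dx) -(edom_fineK dV') /= -EFinD !lee_fin -/c.
rewrite [scalprod 0 _]big1 => [|i _]; last by rewrite mxE mul0r.
lra.
Qed.

Variables (dt : R) (U W : nat -> 'rV[R]_M).
Hypothesis dt_gt0 : 0 < dt.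
Hypothesis W_subdiff : forall n, subdiff F (U n.+3) (W n).
Hypothesis BDF3E : forall n, - dt *: W n =
  (11 / 6) *: U n.+3 - 3 *: U n.+2 + (3 / 2) *: U n.+1 - (1 / 3) *: U n.

Let d n := U n.+1 - U n.

Lemma BDF3_diff n :
  - dt *: W n = (11 / 6) *: d n.+2 - (7 / 6) *: d n.+1 + (1 / 3) *: d n.
Proof. by rewrite BDF3E /d; apply/rowP => i; rewrite !mxE; field. Qed.

Lemma BDF3_gamma3 n :
  scalprod (- dt *: W n) (d n.+2)
  = \sum_(i < M) gamma3 (d n.+2 0 i) (d n.+1 0 i) (d n 0 i).
Proof.
by rewrite BDF3_diff; apply: eq_bigr => i _; rewrite !mxE /gamma3; field.
Qed.

Lemma BDF3_diff_cvg0 :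
  (-oo < ereal_inf (range F))%E ->
  semiconvexity_const F * dt < 2 * beta3 R ->
  d @ \oo --> (0 : 'rV[R]_M).
Proof.
move=> F_inf dt_small.
have c0 := semiconvexity_const_ge0 F.
have [beta adm small] :=
  lt_beta3_admissible (mulr_ge0 c0 (ltW dt_gt0)) dt_small.
have [q q0 qdiss] := beta3_admissible_dissipation adm.
have [m mF] : exists m : R, forall V, edom F V -> m <= fine (F V).
  have [V0 dV0] := F_proper.2.
  have infF V : (ereal_inf (range F) <= F V)%E.
    by apply: ereal_inf_lbound; exists V.
  have inf_fin : ereal_inf (range F) \is a fin_num.
    by rewrite fin_numE gt_eqF //= lt_eqF // (le_lt_trans (infF V0)).
  exists (fine (ereal_inf (range F))) => V dV.
  by apply: fine_le => //; rewrite fin_numE F_proper.1 lt_eqF.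
have dU n : edom F (U n.+3) by have [] := W_subdiff n.
pose Q n := \sum_(i < M) q (d n.+1 0 i) (d n 0 i).
(* Subgradients exist from [U 3] on; [Q n.+1] involves [d n.+2] and [d n.+1], the last two
   increments up to [U n.+3]. *)
pose E n := dt * fine (F (U n.+3)) + Q n.+1.
have Q0 n : 0 <= Q n by apply: sumr_ge0.
have cvgd : scalprod (d n.+3) (d n.+3) @[n --> \oo] --> (0 : R).
  (* The rate is the gain [beta] from the quadratic forms minus the semiconvexity loss; it is
     positive by [small]. *)
  apply: (@cvg0_dissipation _ E _ (beta - semiconvexity_const F * dt / 2) (dt * m)).
  - lra.
  - by move=> n; exact: scalprod_ge0.
  - by move=> n; rewrite /E ler_wpDr // ler_pM2l // mF.
  move=> n.
  have Qdiss : Q n.+2 + beta * scalprod (d n.+3) (d n.+3)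
      <= Q n.+1 + scalprod (- dt *: W n.+1) (d n.+3).
    rewrite BDF3_gamma3 /Q /scalprod mulr_sumr -!big_split /=.
    by apply: ler_sum => i _; rewrite -expr2; exact: qdiss.
  (* The subgradient at [U n.+4] is tested at the previous point [U n.+3], so the displacement is
     [- d n.+3]. *)
  have := subdiff_fine (W_subdiff n.+1) (dU n).
  rewrite enorm_sqr; set X := U n.+3 - U n.+4.
  have XE : X = - d n.+3 by rewrite /X /d opprB.
  have -> : scalprod X X = scalprod (d n.+3) (d n.+3).
    by rewrite XE; apply: eq_bigr => i _; rewrite !mxE mulrNN.
  have dWE : scalprod (- dt *: W n.+1) (d n.+3) = dt * scalprod (W n.+1) X.
    rewrite XE /scalprod mulr_sumr; apply: eq_bigr => i _; rewrite !mxE; ring.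
  move: Qdiss; rewrite dWE /E.
  set s := scalprod (d n.+3) _; set w := scalprod (W n.+1) X.
  set f1 := fine (F (U n.+4)); set f0 := fine (F (U n.+3)).
  move=> Qdiss /(ler_wpM2l (ltW dt_gt0)); lra.
rewrite -(cvg_shiftn 3); apply: cvg_scalprod_self0.
rewrite (_ : [sequence d (n + 3)%N]_n = fun n => d n.+3) //.
by apply/funext => n; rewrite /= addn3.
Qed.

Lemma BDF3_subgrad_cvg0 :
  d @ \oo --> (0 : 'rV[R]_M) -> W @ \oo --> (0 : 'rV[R]_M).
Proof.
move=> d0.
have -> : W = fun n => (- dt)^-1 *:
    ((11 / 6) *: d n.+2 - (7 / 6) *: d n.+1 + (1 / 3) *: d n).
  by apply/funext => n; rewrite -BDF3_diff scalerA mulVf ?scale1r// oppr_eq0 gt_eqF.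
have d1 : d n.+1 @[n --> \oo] --> (0 : 'rV[R]_M) by rewrite cvg_shiftS.
have d2 : d n.+2 @[n --> \oo] --> (0 : 'rV[R]_M).
  by rewrite (cvg_shiftS (fun n => d n.+1)).
rewrite -[X in _ --> X](scaler0 _ (- dt)^-1); apply: cvgZr.
have -> : (0 : 'rV[R]_M) = (11 / 6) *: 0 - (7 / 6) *: 0 + (1 / 3) *: 0.
  by rewrite !scaler0 subrr addr0.
by apply: cvgD; [apply: cvgB|]; apply: cvgZr.
Qed.

End BDF3.

Theorem corollary3p5 (R : realType) (M : nat) (F : 'rV[R]_M -> \bar R)
  (F_proper : eproper F)
  (F_lsc : lower_semicontinuous F)
  (F_semiconvex : exists c : R, semiconvex_with F c)
  (F_cont_dom : {within edom F, continuous F})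
  (F_inf : (-oo < ereal_inf (range F))%E)
  (dt : R) (dt_gt0 : 0 < dt)
  (U : nat -> 'rV[R]_M)
  (U_bounded : exists C : R, forall n, enorm (U n) <= C)
  (U_BDF3 : forall n : nat,
    [set - dt *: W | W in subdiff F (U n.+3)]
      ((11 / 6) *: U n.+3 - 3 *: U n.+2 + (3 / 2) *: U n.+1 - (1 / 3) *: U n))
  (dt_small : semiconvexity_const F * dt < 2 * beta3 R) :
  [/\ bdiff U n @[n --> \oo] --> (0 : 'rV[R]_M),
      compact (omega_limit U),
      connected (omega_limit U) &
      omega_limit U `<=` critical_points F].
Proof.
have /choice[W /all_and2[W_subdiff BDF3E]] n : exists W, subdiff F (U n.+3) W /\
    - dt *: W =
      (11 / 6) *: U n.+3 - 3 *: U n.+2 + (3 / 2) *: U n.+1 - (1 / 3) *: U n.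
  by have [W ? ?] := U_BDF3 n; exists W.
have d0 := BDF3_diff_cvg0 F_proper dt_gt0 W_subdiff BDF3E F_inf dt_small.
have W0 := BDF3_subgrad_cvg0 dt_gt0 BDF3E d0.
have [C UC] := U_bounded.
(* A max-norm ball: it contains the sequence because the max norm is at most the Euclidean one. *)
pose K := [set V : 'rV[R]_M | `|V| <= C].
have clK : closed K.
  apply: (closed_comp (f := @Num.norm _ 'rV[R]_M)) (@closed_le _ C) => V _.
  exact: norm_continuous.
have cK : compact K.
  apply: bounded_closed_compact clK; exists C; split; first exact: num_real.
  by move=> r Cr V VC; exact: (le_trans VC (ltW Cr)).
have KU n : K (U n) by exact: le_trans (normr_le_enorm _) (UC n).
split.
(* The shift discards the default [bdiff U 0] and leaves the increments of [d0]. *)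
- by rewrite -(cvg_shiftS (bdiff U)).
- rewrite omega_limitE.
  apply: (@subclosed_compact _ _ K) => //.
    by rewrite clusterE; apply: closed_bigI => A _; exact: closed_closure.
  rewrite clusterE => x; rewrite ((closure_id _).1 clK); apply.
  by exists 0%N => // n _; exact: KU.
- by rewrite omega_limitE; exact: connected_cluster_slow cK KU d0.
- exact: (omega_limit_subset_critical F_proper W_subdiff F_lsc W0).
Qed.
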